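(* Let $T$ be a rooted, chain complete tree endowed with the countably coarse wedge topology $\tau_{\sigma\text{-cw}}$. Then $(T,\tau_{\sigma\text{-cw}})$ is countably compact and Fréchet–Urysohn.
   Context: A tree is a partially ordered set $(T,\leq)$ such that for every $t\in T$ the set $\{s\in T: s<t\}$ is well-ordered by $<$. It is rooted if it has exactly one minimal element, and chain complete if every chain (totally ordered subset) has a supremum. For $t\in T$, $\mathrm{ht}(t,T)$ is the order type of $\{s\in T: s<t\}$, and $\mathrm{cf}(t)$ is the cofinality of $\mathrm{ht}(t,T)$, with the convention $\mathrm{cf}(t)=0$ if $\mathrm{ht}(t,T)$ is $0$ or a successor ordinal. Put $V_t=\{s\in T: s\geq t\}$. The countably coarse wedge topology $\tau_{\sigma\text{-cw}}$ on $T$ is the topology whose subbase consists of all sets $V_t$ and $T\setminus V_t$ with $t\in T$, $\mathrm{cf}(t)\neq\omega$. A topological space $X$ is countably compact if every countable open cover of $X$ has a finite subcover (equivalently, for Hausdorff spaces, every infinite subset has an accumulation point). $X$ is Fréchet–Urysohn if for every $A\subseteq X$ and $x\in\overline{A}$ there is a sequence in $A$ converging to $x$. *)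

(* Defs.v *)
From HB Require Import structures.
From mathcomp Require Import all_boot all_order.
From mathcomp Require Import all_classical topology.
From mathcomp Require wochoice.

Set Implicit Arguments.
Unset Strict Implicit.
Unset Printing Implicit Defensive.

Import Order.TTheory.
Local Open Scope classical_set_scope.
Local Open Scope order_scope.

Section OrderTypes.
Context {d d' : Order.disp_t} {T : porderType d} {U : porderType d'}.

(* Ordinals are represented by the well-ordered subsets of partial orders;
   below, [A] and [B] are meant to be such subsets. The bijections are between
   the subsets seen as types, so that nothing is required outside of them. *)
Definition order_type_eq (A : set T) (B : set U) : Prop :=
  exists2 f : A -> B, bijective f &
    forall x y : A, (val (f x) <= val (f y)) = (val x <= val y).

Definition initial_segment (B S : set U) : Prop :=
  S `<=` B /\ forall x y, S x -> B y -> y <= x -> S y.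

End OrderTypes.

(* The order type of [A] is at most that of [B]: [A] is isomorphic to an initial
   segment of [B]. *)
Definition order_type_le {d d' : Order.disp_t} {T : porderType d}
    {U : porderType d'} (A : set T) (B : set U) : Prop :=
  exists2 S : set U, initial_segment B S & order_type_eq A S.

Section Cofinality.
Context {d : Order.disp_t} {T : porderType d}.

Definition cofinal (A C : set T) : Prop :=
  C `<=` A /\ forall x, A x -> exists2 y, C y & x <= y.

(* A well-ordered set has a successor order type iff it has a maximum. *)
Definition zero_or_successor (A : set T) : Prop :=
  A = set0 \/ A `&` ubound A !=set0.

(* The cofinality of the order type of [A] is the order type of [B]: the least
   order type of a cofinal subset of [A], with the convention that it is 0 (and
   not 1) when the order type of [A] is a successor. *)
Definition has_cofinality {d' : Order.disp_t} {U : porderType d'}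
    (A : set T) (B : set U) : Prop :=
  (zero_or_successor A /\ B = set0) \/
  [/\ ~ zero_or_successor A,
      exists2 C, cofinal A C & order_type_eq C B &
      forall C, cofinal A C -> order_type_le B C].

End Cofinality.

Section Trees.
Context {d : Order.disp_t} (T : porderType d).

Definition tree : Prop :=
  forall t : T, wochoice.wo_chain (<=%O : rel T) [pred s | s < t].

Definition minimal (r : T) : Prop := forall s : T, s <= r -> s = r.

Definition rooted : Prop := exists! r : T, minimal r.

Definition chain_complete : Prop :=
  forall C : set T, total_on C (fun x y => x <= y) -> supremums C !=set0.

(* cf(t) = omega *)
Definition cf_omega (t : T) : Prop :=
  has_cofinality [set s : T | s < t] [set: nat].

Definition wedge (t : T) : set T := [set s | t <= s].

Definition sigma_cw_subbase : set (set T) :=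
  [set W | exists2 t, ~ cf_omega t & W = wedge t \/ W = ~` wedge t].

End Trees.

(* An alias of [T] carrying the countably coarse wedge topology. *)
Definition sigma_cw (T : Type) : Type := T.

Section SigmaCw.
Context {d : Order.disp_t} (T : porderType d).

HB.instance Definition _ := Order.POrder.copy (sigma_cw T) T.
HB.instance Definition _ := @isSubBaseTopological.Build (sigma_cw T)
  (set T) (@sigma_cw_subbase d T) id.

End SigmaCw.

Definition countably_compact (X : topologicalType) : Prop :=
  forall (I : choiceType) (D : set I) (f : I -> set X), countable D ->
    (forall i, D i -> open (f i)) -> [set: X] `<=` cover D f ->
    finite_subset_cover D f [set: X].

Definition frechet_urysohn (X : topologicalType) : Prop :=
  forall (A : set X) (x : X), closure A x ->
    exists2 u : nat -> X, (forall n, A (u n)) & u @ \oo --> x.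

(* Main.v *)
Require Import Defs.
From HB Require Import structures.
From mathcomp Require Import all_boot all_order.
From mathcomp Require Import finmap.
From mathcomp Require Import all_classical topology.
From mathcomp Require wochoice.

(** Two wedges of a tree are either disjoint or nested. Hence an ultrafilter [U]
    on the tree singles out a chain, the set [C] of those [t] whose wedge [V_t]
    belongs to [U], and this chain has a supremum [c]. A wedge [V_t] with [t] not
    below [c] is not in [U], and every [V_t] with [t < c] is, so [U] converges to
    [c] as soon as it contains [V_c] or [V_c] is not in the subbase.

    Countable compactness. Let [U] be the image of an ultrafilter on [nat] under
    a sequence [u]. If [V_c] is not in [U], then [c] is a limit, and each [u n]
    outside [V_c] branches off from [c] at some [m n < c]. If the [m n] were
    bounded by some [s < c], then all terms of [u] in [V_s] would lie in [V_c],
    although [V_s] belongs to [U]; thus the [m n] are cofinal below [c],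
    [cf(c) = omega], and [V_c] is not in the subbase
    ([ultrafilter_sequence_cvg]). So every sequence converges along every
    ultrafilter on [nat], and a sequence that leaves, one after the other, the
    members of a countable open cover would contradict this.

    Frechet-Urysohn. Let [x] be in the closure of [A] but not in [A]. Either [x]
    is in the closure of the part of [A] above [x]: then that part meets
    infinitely many of the wedges of immediate successors of [x], and one point
    from each of them makes a convergent sequence ([closure_above_sequence]). Or
    [x] is in the closure of the rest of [A]: then [V_x] is not open, so
    [cf(x) = omega], and points of this rest taken above the members of a
    cofinal omega-sequence below [x] converge to [x] ([closure_below_sequence]). *)

Set Implicit Arguments.
Unset Strict Implicit.
Unset Printing Implicit Defensive.

Import Order.TTheory.
Local Open Scope order_scope.
Local Open Scope classical_set_scope.

(** * Order in chain complete trees *)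

Section TreeOrder.
Context {d : Order.disp_t} {T : porderType d}.
Context (treeT : tree T).

Lemma tree_below_total (x s t : T) : s <= x -> t <= x -> s <= t \/ t <= s.
Proof.
rewrite !le_eqVlt => /orP[/eqP-> /orP[/eqP->|->]|sx /orP[/eqP->|tx]].
- by left; rewrite eqxx.
- by right; rewrite orbT.
- by left; rewrite sx orbT.
have /orP := @wochoice.wo_chainW T <=%O _ (@treeT x) s t sx tx.
by rewrite -!le_eqVlt.
Qed.

(** The definition of a tree well-orders the elements strictly below [x]; adding
    [x] on top of them keeps every nonempty part with a least element. *)
Lemma tree_below_min (A : set T) (x : T) : (exists2 s, A s & s <= x) ->
  exists m, [/\ A m, m <= x & forall s, A s -> s <= x -> m <= s].
Proof.
move=> [s As sx].
have [[u Au ux]|noA] := pselect (exists2 u, A u & u < x); last first.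
  exists x; have eqx u : A u -> u <= x -> u = x.
    by move=> Au; rewrite le_eqVlt => /orP[/eqP//|ux]; case: noA; exists u.
  split=> //; first by rewrite -(eqx s).
  by move=> u Au /(eqx _ Au) ->.
pose B : pred T := fun v => `[< A v >] && (v < x).
have [||m [[/andP[/asboolP Am mx] minm] _]] := @treeT x B.
- by move=> v /andP[].
- by exists u; rewrite unfold_in /B ux asboolT.
exists m; split=> //; first exact: ltW.
move=> v Av; rewrite le_eqVlt => /orP[/eqP->|vx]; first exact: ltW.
by apply: minm; rewrite unfold_in /B vx asboolT.
Qed.

Lemma tree_successor (x y : T) : x < y ->
  exists s, [/\ x < s, s <= y & forall u, x < u -> u <= y -> s <= u].
Proof.
move=> xy; apply: (@tree_below_min [set u | x < u]).
by exists y.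
Qed.

Lemma rooted_bottom : rooted T -> exists r : T, forall t, r <= t.
Proof.
move=> [r [_ uniq_r]]; exists r => t.
have [|m [_ mt minm]] := @tree_below_min setT t; first by exists t.
rewrite (uniq_r m) // => s sm; apply/eqP; rewrite eq_le sm /=.
by apply: minm => //; exact: le_trans mt.
Qed.

Context (complT : chain_complete T).

(** The common lower bounds of [s] and [t] form a chain because they all lie
    below [s]; chain completeness gives its supremum. *)
Lemma tree_meet (s t : T) :
  exists m, [/\ m <= s, m <= t & forall u, u <= s -> u <= t -> u <= m].
Proof.
have [|m [ubm lubm]] := complT (C := [set u | u <= s /\ u <= t]).
  by move=> u v [us _] [vs _]; exact: (@tree_below_total s).
exists m; split.
- by apply: lubm => u [].
- by apply: lubm => u [].
- by move=> u us ut; apply: ubm.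
Qed.

(** The supremum of the elements strictly below a limit [x] can only be [x]:
    were it smaller, it would be the largest of them. Chain completeness thus
    excludes two limit elements with the same predecessors. *)
Lemma limit_least_ub (x t : T) : ~ zero_or_successor [set s : T | s < x] ->
  ubound [set s | s < x] t -> x <= t.
Proof.
move=> limx ubt.
have [|c [ubc lubc]] := complT (C := [set s | s < x]).
  by move=> u v ux vx; apply: (@tree_below_total x); exact: ltW.
have cx : c <= x by apply: lubc => u; exact: ltW.
move: cx; rewrite le_eqVlt => /orP[/eqP<-|cx]; first exact: lubc.
by case: limx; right; exists c.
Qed.

End TreeOrder.

(** * Cofinality omega *)

Lemma order_type_eq_sym (d d' : Order.disp_t) (T : porderType d)
    (U : porderType d') (A : set T) (B : set U) :
  order_type_eq A B -> order_type_eq B A.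
Proof.
move=> [f [g fK gK] fle]; exists g; first by exists f.
by move=> x y; rewrite -fle !gK.
Qed.

Section OmegaCofinality.
Context {d : Order.disp_t} {T : porderType d}.

Lemma limit_nonempty (x : T) :
  ~ zero_or_successor [set s | s < x] -> exists s, s < x.
Proof.
move=> limx; apply: contrapT => nos; apply: limx; left.
by apply/seteqP; split=> // s sx; apply: nos; exists s.
Qed.

Lemma increasing_range_order_type (h : nat -> T) :
  (forall n, h n < h n.+1) -> order_type_eq [set: nat] (range h).
Proof.
move=> hS.
have hle : {mono h : m n / (m <= n)%N >-> m <= n}.
  by apply: le_mono; apply: homo_ltn hS => ? ? ?; exact: lt_trans.
have hmem (n : [set: nat]) : h (val n) \in range h.
  by rewrite inE; exists (val n).
exists (fun n => SigSub (hmem n)); last by move=> m n /=; rewrite hle leEnat.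
pose g (y : range h) : [set: nat] :=
  SigSub (mem_set (I : setT (s2val (cid2 (set_valP y))))).
exists g => [n|y]; apply: val_inj => /=.
  case: cid2 => //= m _ /eqP.
  by rewrite (inj_eq (inc_inj hle)) => /eqP.
by case: cid2.
Qed.

Context (treeT : tree T).

Lemma limit_cofinal_next (x : T) (C : set T) :
  ~ zero_or_successor [set s | s < x] -> cofinal [set s | s < x] C ->
  forall u, u < x ->
  exists v, [/\ C v, u < v & forall w, C w -> u < w -> v <= w].
Proof.
move=> limx [Cx Ccof] u ux.
have [y yx yu] : exists2 y, y < x & ~ y <= u.
  apply: contrapT => noy; apply: limx; right; exists u; split=> // y /= yx.
  by apply: contrapT => yu; apply: noy; exists y.
have [c Cc yc] := Ccof _ yx.
have uc : u < c.
  have [cu|uc] := tree_below_total treeT (ltW (Cx _ Cc)) (ltW ux).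
    by case: yu; exact: le_trans cu.
  by rewrite lt_neqAle uc andbT; apply/eqP => euc; rewrite euc in yu.
have [|m [[Cm um] _ minm]] :=
    @tree_below_min _ _ treeT [set w | C w /\ u < w] x.
  by exists c => //; exact/ltW/Cx.
by exists m; split=> // w Cw uw; apply: minm => //; exact/ltW/Cx.
Qed.

(** Taking the least element of [C], then each time the next one, enumerates an
    initial segment of [C]; this never stops, as [C] has no maximum. *)
Lemma omega_le_cofinal (x : T) (C : set T) :
  ~ zero_or_successor [set s | s < x] -> cofinal [set s | s < x] C ->
  order_type_le [set: nat] C.
Proof.
move=> limx cofC; have [Cx Ccof] := cofC.
have [c Cc] : exists c, C c.
  have [y yx] := limit_nonempty limx.
  by have [c Cc _] := Ccof _ yx; exists c.
have [|c0 [Cc0 _ minc0]] := @tree_below_min _ _ treeT C x.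
  by exists c => //; exact/ltW/Cx.
have /choice[next nextP] u : exists v, u < x ->
    [/\ C v, u < v & forall w, C w -> u < w -> v <= w].
  have [ux|nux] := pselect (u < x); last by exists u => /nux.
  by have [v vP] := limit_cofinal_next limx cofC ux; exists v.
pose h := fix h n := if n is n'.+1 then next (h n') else c0.
have Ch n : C (h n).
  by elim: n => [//|n /Cx/nextP[]].
have hS n : h n < h n.+1 by have /Cx/nextP[] := Ch n.
exists (range h); last exact: increasing_range_order_type.
split; first by move=> _ [n _ <-].
move=> _ y [n _ <-] Cy; elim: n => [|n IHn] yh.
  exists 0%N => //; apply/eqP; rewrite eq_le yh andbT.
  by apply: minc0 => //; exact/ltW/Cx.
have [hy|hny] := pselect (h n < y).
  exists n.+1 => //; apply/eqP; rewrite eq_le yh andbT.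
  by have /Cx/nextP[_ _] := Ch n; apply.
apply: IHn.
have [//|] := tree_below_total treeT (ltW (Cx _ Cy)) (ltW (Cx _ (Ch n))).
by rewrite le_eqVlt => /orP[/eqP->|/hny].
Qed.

(** A countable cofinal set is enough for cofinality omega: climbing above the
    [m n] one at a time gives a strictly increasing sequence that is still
    cofinal, and no cofinal set is shorter by [omega_le_cofinal]. *)
Lemma sequence_cf_omega (x : T) (m : nat -> T) :
  ~ zero_or_successor [set s | s < x] -> (forall n, m n < x) ->
  (forall s, s < x -> exists n, s <= m n) -> cf_omega x.
Proof.
move=> limx mx mcof; right; split=> //; last first.
  by move=> C; exact: omega_le_cofinal.
have /choice[next nextP] (p : nat * T) : exists v, p.2 < x ->
    [/\ v < x, p.2 < v & m p.1 <= v].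
  have [ux|nux] := pselect (p.2 < x); last by exists x => /nux.
  have [|v [vx uv minv]] := limit_cofinal_next (C := [set s | s < x]) limx _ ux.
    by split=> // s sx; exists s.
  have [mv|vm] := tree_below_total treeT (ltW (mx p.1)) (ltW vx).
    by exists v.
  by exists (m p.1); split=> //; exact: lt_le_trans vm.
pose h := fix h n := if n is n'.+1 then next (n', h n') else m 0%N.
have hx n : h n < x by elim: n => [|n /(nextP (n, _))[]] /=.
exists (range h); last first.
  apply: order_type_eq_sym; apply: increasing_range_order_type => n.
  by have [] := nextP (n, h n) (hx n).
split; first by move=> _ [n _ <-]; exact: hx.
move=> s /mcof[n sm]; exists (h n.+1); first by exists n.+1.
by apply: le_trans sm _; have [] := nextP (n, h n) (hx n).
Qed.

Lemma cf_omega_sequence (x : T) : cf_omega x ->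
  ~ zero_or_successor [set s | s < x] /\
  exists g : nat -> T, [/\ forall n, g n < x,
    forall m n, (m <= n)%N -> g m <= g n &
    forall s, s < x -> exists n, s <= g n].
Proof.
case=> [[_ /seteqP[/(_ 0%N I)]] //|[limx [C [Cx Ccof] CN] _]]; split=> //.
have [f [f' fK f'K] fle] := order_type_eq_sym CN.
pose g n := val (f (SigSub (mem_set (I : [set: nat] n)))).
exists g; split.
- by move=> n; apply: Cx; exact: set_valP.
- by move=> m n mn; rewrite /g fle.
move=> s /Ccof[c Cc sc]; exists (val (f' (SigSub (mem_set Cc)))).
rewrite /g; set k := SigSub _.
suff -> : k = f' (SigSub (mem_set Cc)) by rewrite f'K.
exact: val_inj.
Qed.

End OmegaCofinality.

(** * The countably coarse wedge topology *)

Section Topology.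
Context {d : Order.disp_t} {T : porderType d}.

Lemma open_subbase (W : set (sigma_cw T)) :
  @sigma_cw_subbase _ T W -> open W.
Proof.
move=> subW; exists [set W]; last by rewrite bigcup_set1.
move=> _ ->; exists [fset (W : set T)]%fset.
  by move=> A; rewrite in_fset1 => /eqP->; rewrite inE.
by rewrite set_fset1 bigcap_set1.
Qed.

Lemma open_wedge (t : T) : ~ cf_omega t -> open (wedge t : set (sigma_cw T)).
Proof. by move=> tN; apply: open_subbase; exists t => //; left. Qed.

Lemma open_wedgeC (t : T) :
  ~ cf_omega t -> open (~` wedge t : set (sigma_cw T)).
Proof. by move=> tN; apply: open_subbase; exists t => //; right. Qed.

Lemma cvg_sigma_cw (F : set_system (sigma_cw T)) (x : sigma_cw T) : Filter F ->
  (forall t : T, ~ cf_omega t -> t <= x -> F (wedge t)) ->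
  (forall t : T, ~ cf_omega t -> ~ t <= x -> F (~` wedge t)) ->
  F --> x.
Proof.
move=> FF Fin Fout A; rewrite nbhsE => -[B [[D sD <-] [E DE Ex]] BA].
apply: filterS (subset_trans (bigcup_sup DE) BA) _.
have [K sK KE] := sD _ DE; rewrite -KE in Ex *.
apply: filter_bigI => W WK.
have := sK _ WK; rewrite inE => -[t tN [] eW]; move: (Ex _ WK); rewrite eW.
  exact: Fin.
exact: Fout.
Qed.

Context (treeT : tree T) (rootT : rooted T) (complT : chain_complete T).

(** The limit is the supremum [c] of the points whose wedges contain the terms
    of [u] for [G]-almost all indices. That the terms form a sequence matters
    only when [c] is not such a point: it bounds the cofinality of [c]. *)
Lemma ultrafilter_sequence_cvg (G : set_system nat) (u : nat -> T) :
  UltraFilter G ->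
  exists c : T, (u @ G : set_system (sigma_cw T)) --> (c : sigma_cw T).
Proof.
move=> GU.
have [r rP] := rooted_bottom treeT rootT.
pose C : set T := [set t | G (u @^-1` wedge t)].
have Ctot : total_on C (fun s t => s <= t).
  move=> s t Cs Ct.
  have /filter_ex[n [/= sn tn]] : G (u @^-1` wedge s `&` u @^-1` wedge t).
    exact: filterI.
  exact: (@tree_below_total _ T treeT (u n) s t sn tn).
have Cdown s t : s <= t -> C t -> C s.
  by move=> st; apply: filterS => n; exact: le_trans.
have [c [ubc lubc]] := complT Ctot.
have ltcC s : s < c -> C s.
  move=> sc; apply: contrapT => nCs.
  suff /lubc/le_gtF : ubound C s by rewrite sc.
  move=> t Ct; have [//|st] := tree_below_total treeT (ubc _ Ct) (ltW sc).
  by case: nCs; exact: Cdown Ct.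
(* The only wedge that convergence to [c] leaves in doubt is that of [c]. *)
have cvgc : (~ cf_omega c -> C c) ->
    (u @ G : set_system (sigma_cw T)) --> (c : sigma_cw T).
  move=> Cc; apply: cvg_sigma_cw => t tN.
    rewrite le_eqVlt => /orP[/eqP etc|/ltcC//].
    by rewrite etc in tN *; exact: Cc.
  move=> tc; have [Ct|//] := in_ultra_setVsetC (u @^-1` wedge t) GU.
  by case: tc; exact: ubc.
exists c; apply: cvgc => cN; apply: contrapT => nCc; apply: cN.
have limc : ~ zero_or_successor [set s | s < c].
  case=> [c0|[s [/= sc ubs]]].
    suff rc : r < c by have : [set s | s < c] r by []; rewrite c0.
    rewrite lt_neqAle rP andbT; apply/eqP => erc.
    apply: nCc; rewrite /C /= -erc.
    by apply: filterS filterT => n _; exact: rP.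
  have : ubound C s.
    move=> t Ct; apply: ubs; rewrite /= lt_neqAle ubc // andbT.
    by apply/eqP => etc; rewrite etc in Ct.
  by move=> /lubc/le_gtF; rewrite sc.
(* [m n] is the meet of [c] and [u n] when [u n] is not above [c]; the terms
   above [c] contribute an arbitrary point below [c], so that [m] is total. *)
have /choice[m mP] n : exists m, m < c /\
    (~ c <= u n -> forall s, s <= c -> s <= u n -> s <= m).
  have [cu|ncu] := pselect (c <= u n).
    by have [s sc] := limit_nonempty limc; exists s.
  have [m [mc mu mmax]] := tree_meet treeT complT c (u n).
  exists m; split=> //; rewrite lt_neqAle mc andbT.
  by apply/eqP => emc; rewrite emc in mu.
apply: (@sequence_cf_omega _ _ treeT c m) => // [n|s sc].
  by have [] := mP n.
(* If [s] exceeds all the meets, the terms of [u] above [s] are above [c]. *)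
apply: contrapT => nos; apply: nCc; apply: filterS (ltcC _ sc) => n /= su.
apply: contrapT => ncu; apply: nos; exists n.
by have [_] := mP n; apply => //; exact: ltW.
Qed.

Lemma countably_compact_sigma_cw : countably_compact (sigma_cw T).
Proof.
move=> I D f /countable_injP[e einj] fopen fcover; apply: contrapT => nocover.
(* [u n] avoids the members of the cover with code at most [n], so each member
   contains only finitely many terms of [u]. *)
pose D_ n : set I := D `&` e @^-1` `I_n.+1.
have finD n : finite_set (D_ n).
  have /injfunPex[g] : exists2 g : I -> nat, set_fun (D_ n) `I_n.+1 g &
      set_inj (D_ n) g.
    exists e => [i []//|]; apply: sub_in2 einj => i.
    by rewrite !inE => -[].
  exact: card_le_finite (inj_card_le g) (finite_II _).
have /choice[u uP] n : exists x : sigma_cw T, forall i, D_ n i -> ~ f i x.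
  apply: contrapT => nox; apply: nocover; exists (fset_set (D_ n)).
    by move=> i; rewrite in_fset_set // !inE => -[].
  move=> x _; apply: contrapT => ncx; apply: nox; exists x => i Di fx.
  by apply: ncx; exists i => //=; rewrite in_fset_set // inE.
have [G [GU Goo]] := @ultraFilterLemma nat \oo _.
have [c uc] := ultrafilter_sequence_cvg u GU.
have [i Di fic] := fcover c Logic.I.
have : G (u @^-1` f i).
  by apply: uc; apply: open_nbhs_nbhs; split=> //; exact: fopen.
have : G [set n | e i <= n]%N by apply: Goo; exists (e i).
move=> /filterI/[apply]/filter_ex[n [/= ein]]; apply: uP.
by split.
Qed.

Lemma successor_not_cf_omega (x s : T) : x < s ->
  (forall u, x < u -> u <= s -> s <= u) -> ~ cf_omega s.
Proof.
move=> xs mins /cf_omega_sequence[lims _]; apply: lims; right.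
exists x; split=> // u /= us.
have [//|] := tree_below_total treeT (ltW us) (ltW xs).
rewrite le_eqVlt => /orP[/eqP->//|xu].
by have /le_gtF := mins _ xu (ltW us); rewrite us.
Qed.

(** Immediate successors of [x] have open and closed wedges missing [x], so
    finitely many of them cannot cover the part of [A] above [x]. A choice of
    points of [A] in infinitely many such wedges converges to [x]. *)
Lemma closure_above_sequence (A : set (sigma_cw T)) (x : sigma_cw T) :
  ~ A x -> closure (A `&` wedge x) x ->
  exists2 u : nat -> sigma_cw T, (forall n, A (u n)) & u @ \oo --> x.
Proof.
move=> nAx clx.
pose S : set T := [set s | [/\ (x : T) < s,
  forall u, (x : T) < u -> u <= s -> s <= u & exists2 a : T, A a & s <= a]].
have /infiniteP/card_leP[f] : infinite_set S.
  move=> finS.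
  pose W : set (sigma_cw T) := \bigcup_(s in S) wedge s.
  have /closed_openC Wo : closed W.
    apply: closed_bigcup => // s [xs mins _].
    rewrite -openC; apply: open_wedgeC.
    exact: successor_not_cf_omega xs mins.
  have nWx : ~ W x.
    by move=> [s [xs _ _] sx]; move: (lt_le_trans xs sx); rewrite ltxx.
  have [|a [[Aa xa] Wa]] := clx (~` W); first exact: open_nbhs_nbhs.
  have {}xa : (x : T) < a.
    by rewrite lt_neqAle xa andbT; apply/eqP => exa; rewrite exa in nAx.
  have [s [xs sa mins]] := tree_successor treeT xa.
  apply: Wa; exists s => //; split=> //; last by exists a.
  by move=> u xu us; apply: mins => //; exact: le_trans sa.
pose h n : T := val (f (to_setT n)).
have Sh n : S (h n) by exact: set_valP.
have hinj m n : h m = h n -> m = n.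
  by move=> /val_inj/inj; rewrite !inE => /(_ I I) [].
have /choice[a aP] n : exists a : T, A a /\ h n <= a.
  by have [_ _ [a Aa ha]] := Sh n; exists a.
exists a => [n|]; first by have [] := aP n.
apply: (@cvg_sigma_cw (a @ \oo)) => t tN tx.
  exists 0%N => // n _; apply: le_trans tx _.
  by have [/ltW xh _ _] := Sh n; apply: le_trans xh _; have [] := aP n.
(* A wedge missing [x] contains at most one term, because it lies inside the
   wedge of a single immediate successor of [x] or misses all the terms. *)
have hle n : t <= a n -> h n <= t.
  move=> ta; have [xh minh _] := Sh n; have [_ ha] := aP n.
  have [//|th] := tree_below_total treeT ha ta.
  apply: minh th; have xa : (x : T) <= a n by exact: le_trans (ltW xh) ha.
  have [//|] := tree_below_total treeT ta xa.
  by rewrite le_eqVlt => /orP[/eqP ext|//]; case: tx; rewrite ext.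
have hsame m n : t <= a m -> t <= a n -> m = n.
  move=> /hle hm /hle hn; apply: hinj.
  have [xm minm _] := Sh m; have [xn minn _] := Sh n.
  have [mn|nm] := tree_below_total treeT hm hn.
    by apply/eqP; rewrite eq_le mn minn.
  by apply/eqP; rewrite eq_le nm minm.
have [[n tn]|no] := pselect (exists n, t <= a n).
  exists n.+1 => // m /= nm tm.
  by rewrite (hsame _ _ tm tn) ltnn in nm.
by exists 0%N => // n _ tn; apply: no; exists n.
Qed.

(** If [cf(x)] were not omega, [V_x] would be a neighbourhood of [x] missing
    [A \ V_x]. So there is an omega-sequence [g] cofinal below [x], and points
    of [A \ V_x] above the [g n] eventually leave each wedge missing [x]. *)
Lemma closure_below_sequence (A : set (sigma_cw T)) (x : sigma_cw T) :
  closure (A `\` wedge x) x ->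
  exists2 u : nat -> sigma_cw T, (forall n, A (u n)) & u @ \oo --> x.
Proof.
move=> clx.
have cfx : cf_omega (x : T).
  apply: contrapT => xN; have [|a [[_ +] xa]] := clx (wedge x); last exact.
  by apply: open_nbhs_nbhs; split; [exact: open_wedge|exact: lexx].
have [limx [g [gx gmono gcof]]] := cf_omega_sequence cfx.
(* The wedge of [g n] need not be open; that of its successor below [x] is. *)
have /choice[a aP] n : exists a : T, [/\ A a, ~ (x : T) <= a & g n <= a].
  have [s [gs sx mins]] := tree_successor treeT (gx n).
  have [|a [[Aa xa] sa]] := clx (wedge s).
    apply: open_nbhs_nbhs; split=> //; apply: open_wedge.
    apply: (successor_not_cf_omega gs) => u gu us.
    by apply: mins => //; exact: le_trans sx.
  by exists a; split=> //; apply: le_trans sa; exact: ltW.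
exists a => [n|]; first by have [] := aP n.
apply: (@cvg_sigma_cw (a @ \oo)) => t tN.
  rewrite le_eqVlt => /orP[/eqP etx|/gcof[N tg]].
    by rewrite etx in tN.
  exists N => // n /= Nn; have [_ _] := aP n; apply: le_trans.
  exact: le_trans tg (gmono _ _ Nn).
move=> tx.
have [xt|xt] := pselect ((x : T) <= t).
  by exists 0%N => // n _ ta; have [_ + _] := aP n; apply; exact: le_trans ta.
have [s sx st] : exists2 s, s < (x : T) & ~ s <= t.
  apply: contrapT => nos; apply: xt.
  apply: (limit_least_ub treeT complT limx) => s sx.
  by apply: contrapT => st; apply: nos; exists s.
have [N sg] := gcof _ sx.
exists N => // n /= Nn ta; have [_ _ ga] := aP n.
have {}sg : s <= g n by exact: le_trans sg (gmono _ _ Nn).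
have [tg|gt] := tree_below_total treeT ta ga.
  by apply: tx; apply: le_trans tg _; exact: ltW.
by apply: st; exact: le_trans gt.
Qed.

Lemma frechet_urysohn_sigma_cw : frechet_urysohn (sigma_cw T).
Proof.
move=> A x; have [Ax _|nAx] := pselect (A x).
  by exists (fun=> x) => //; exact: cvg_cst.
rewrite -{1}(setUIDK A (wedge x)) closureU => -[].
  exact: closure_above_sequence.
exact: closure_below_sequence.
Qed.

End Topology.

Theorem proposition3p2 (d : Order.disp_t) (T : porderType d) :
  tree T -> rooted T -> chain_complete T ->
  countably_compact (sigma_cw T) /\ frechet_urysohn (sigma_cw T).
Proof.
move=> treeT rootT complT; split; first exact: countably_compact_sigma_cw.
exact: frechet_urysohn_sigma_cw.
Qed.
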